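(* Let $m,k\ge1$, $q=2^{km}$, $d=2^m$, $n=(q+1)(d-1)$, $N=(q-1)/(d-1)$, $r=q^2$. Let $\alpha$ be a generator of $\mathrm{GF}(r)^*$, $\beta=\alpha^N$ (an element of order $n$), and $\mathrm{Tr}$ the trace from $\mathrm{GF}(r)$ to $\mathrm{GF}(q)$. Let $\mathcal{C}=\{\mathbf{c}_a:a\in\mathrm{GF}(r)\}\subseteq\mathrm{GF}(q)^n$ where $\mathbf{c}_a=(\mathrm{Tr}(a\beta^0),\mathrm{Tr}(a\beta^1),\dots,\mathrm{Tr}(a\beta^{n-1}))$. Then $\mathcal{C}$ is an $[n,2,n-d+1]$ code over $\mathrm{GF}(q)$ with weight enumerator $1+(q^2-1)z^{(d-1)q}$. Moreover, the minimum distance of the dual code $\mathcal{C}^\perp$ equals $3$ if $m=1$ and $2$ if $m>1$. *)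

(* Defs.v *)
From HB Require Import structures.
From mathcomp Require Import all_boot all_order all_algebra.
From mathcomp Require Import all_fingroup all_solvable all_field.

Set Implicit Arguments.
Unset Strict Implicit.
Unset Printing Implicit Defensive.

Import GRing.Theory.
Local Open Scope ring_scope.

Section Trace.

Variables (F : finFieldType) (L : fieldExtType F).

(* galTrace is valued in L, more precisely in the image 1%VS of F in L; Tr x  *)
(* is its unique preimage in F (see TrE), so the default 0 is never used.     *)
(* The alias finvect_type equips L with its finite and splitting field        *)
(* structures.                                                                *)
Definition Tr (x : finvect_type L) : F :=
  odflt 0 [pick y : F |
    y%:A == galTrace 1%AS {:finvect_type L} x :> finvect_type L].

Lemma TrE (x : finvect_type L) :
  (Tr x)%:A = galTrace 1%AS {:finvect_type L} x :> finvect_type L.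
Proof.
rewrite /Tr; case: pickP => [y /eqP //|noy].
have /vlineP[y Dy] : galTrace 1%AS {:finvect_type L} x \in 1%VS.
  by rewrite mem_galTrace ?memvf ?finField_galois ?sub1v.
by have := noy y; rewrite Dy eqxx.
Qed.

End Trace.

Section Codes.

Variables (F : finFieldType) (n : nat).
Implicit Types (C : {set 'rV[F]_n}) (u v c : 'rV[F]_n).

Definition hamming_distance u v := #|[set i : 'I_n | u 0 i != v 0 i]|.

Definition hamming_weight c := #|[set i : 'I_n | c 0 i != 0]|.

Definition is_min_distance C (delta : nat) :=
  (exists u v, [/\ u \in C, v \in C, u != v & hamming_distance u v = delta]) /\
  (forall u v, u \in C -> v \in C -> u != v ->
    (delta <= hamming_distance u v)%N).

(* C is an [n, kappa, delta] code over F, the length n being carried by the   *)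
(* type of C.                                                                 *)
Definition is_linear_code C (kappa delta : nat) :=
  (exists V : {vspace 'rV[F]_n}, C =i V /\ \dim V = kappa) /\
  is_min_distance C delta.

Definition weight_enumerator C : {poly int} :=
  \sum_(i < n.+1) (#|[set c in C | hamming_weight c == i]|)%:R *: 'X^i.

Definition dual_code C : {set 'rV[F]_n} :=
  [set u : 'rV[F]_n | [forall c in C, \sum_i u 0 i * c 0 i == 0]].

End Codes.

Section TraceCode.

Variables (F : finFieldType) (L : fieldExtType F).
Variables (n : nat) (beta : finvect_type L).

Definition trace_codeword (a : finvect_type L) : 'rV[F]_n :=
  \row_(i < n) Tr (a * beta ^+ i).

Definition trace_code : {set 'rV[F]_n} :=
  [set trace_codeword a | a : finvect_type L].

End TraceCode.

(* Main.v *)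
Require Import Defs.
From HB Require Import structures.
From mathcomp Require Import all_boot all_order all_algebra.
From mathcomp Require Import all_fingroup all_solvable all_field.

Set Implicit Arguments.
Unset Strict Implicit.
Unset Printing Implicit Defensive.

Import GRing.Theory.
Local Open Scope ring_scope.

(* In characteristic 2, Tr x = x + x^q vanishes exactly when x lies in GF(q),  *)
(* and alpha^s lies in GF(q) exactly when q + 1 divides s. So the zero         *)
(* coordinates of c_a, for a = alpha^s, are the i < (q + 1)(d - 1) such that   *)
(* q + 1 divides s + N i; since N is prime to q + 1 there are exactly d - 1 of *)
(* them, whence a single nonzero weight q(d - 1) = n - d + 1. As the trace     *)
(* form is nondegenerate, the dual code is the space of GF(q)-linear relations *)
(* between the powers of beta. Two powers are proportional when their          *)
(* exponents agree mod q + 1, which happens in length n only if d > 2; when    *)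
(* d = 2 a shortest relation is the characteristic polynomial                  *)
(* X^2 - Tr(beta) X + beta^(q + 1).                                            *)

(** The length is treated as [(q + 1) * e], with [e = d - 1] and [N] prime to [q + 1]. The weights
    come from [mem_base_primitive], which turns vanishing of a trace into divisibility by [q + 1],
    and [sum_dvdn_progression], which counts the solutions. For the dual, [dual_trace_codeE]
    identifies codewords with relations between powers of [beta]; [base_independent_powers] excludes
    relations with two terms when [e = 1], and [exp_base_primitive] supplies the coefficients of the
    shortest ones. *)

Lemma sum_dvdn_progression (M e N s : nat) : (0 < M)%N -> coprime M N ->
  (\sum_(i < M * e) (M %| s + N * i) = e)%N.
Proof.
move=> M_gt0 coMN; elim: e s => [|e IHe] s; first by rewrite muln0 big_ord0.
(* Shifting [i] by [M] changes the term by a multiple of [M], so it is enough that one block of [M]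
   indices contains exactly one solution. *)
rewrite mulnS big_split_ord /= -[RHS]add1n -[in RHS](IHe s).
congr (_ + _)%N; last first.
  apply: eq_bigr => i _.
  by rewrite mulnDr addnCA dvdn_addr // dvdn_mull.
(* Here [M] divides [1 + a * N], hence [s + N * (a * s)]: the solution is [a * s] reduced mod
   [M]. *)
have [a _] := Bezoutl N M_gt0; rewrite (eqP coMN) => dvdMa.
have i0P : (M %| s + N * (a * s %% M))%N.
  rewrite /dvdn -modnDmr modnMmr modnDmr -/(dvdn _ _) mulnA -{1}[s]mul1n.
  by rewrite -mulnDl dvdn_mulr // mulnC.
pose i0 := Ordinal (ltn_pmod (a * s) M_gt0).
rewrite (bigD1 i0) //= i0P big1 // => i ne_i; apply/eqP; rewrite eqb0.
apply: contraNN ne_i => dvdMi.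
have : (s + N * i == s + N * i0 %[mod M])%N by rewrite /= (eqP dvdMi) (eqP i0P).
rewrite eqn_modDl.
wlog le_ij : i i0 {dvdMi i0P} / (i <= i0)%N.
  by move=> W; case: (leqP i i0) => [/W //|/ltnW/W{}W /eqP/esym/eqP/W]; rewrite eq_sym.
rewrite eq_sym eqn_mod_dvd ?leq_mul2l ?le_ij ?orbT // -mulnBr Gauss_dvdr //.
rewrite -eqn_mod_dvd // !modn_small ?ltn_ord // => /eqP E.
by apply/eqP/val_inj.
Qed.

(** * Distances and weights in additive codes *)

Section HammingLinear.

Variables (F : finFieldType) (n : nat).
Implicit Types (C : {set 'rV[F]_n}) (u v c : 'rV[F]_n).

Lemma hamming_distanceE u v : hamming_distance u v = hamming_weight (u - v).
Proof. by apply: eq_card => i; rewrite !inE !mxE subr_eq0. Qed.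

Lemma hamming_weight0 : hamming_weight (0 : 'rV[F]_n) = 0%N.
Proof. by apply/eqP; rewrite cards_eq0; apply/eqP/setP => i; rewrite !inE mxE eqxx. Qed.

Lemma is_min_distance_weight C (delta : nat) :
  zmod_closed C -> (exists2 c, c \in C & c != 0 /\ hamming_weight c = delta) ->
  (forall c, c \in C -> c != 0 -> (delta <= hamming_weight c)%N) ->
  is_min_distance C delta.
Proof.
move=> [C0 CB] [c Cc [nz_c wt_c]] le_wt; split=> [|u v Cu Cv ne_uv].
  by exists c, 0; rewrite hamming_distanceE subr0.
by rewrite hamming_distanceE le_wt ?CB // subr_eq0.
Qed.

Lemma weight_enumeratorE C :
  weight_enumerator C = \sum_(c in C) 'X^(hamming_weight c).
Proof.
have lt_wt c : (hamming_weight c < n.+1)%N.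
  by rewrite ltnS (leq_trans (max_card _)) ?card_ord.
rewrite /weight_enumerator (partition_big (fun c => Ordinal (lt_wt c)) predT) //.
apply: eq_bigr => i _.
rewrite (eq_bigr (fun=> 'X^i)) => [|c /andP[_ /eqP<-] //].
rewrite sumr_const scaler_nat; congr (_ *+ _).
by apply: eq_card => c; rewrite !inE.
Qed.

Lemma dual_code_zmod_closed C : zmod_closed (dual_code C).
Proof.
split=> [|u v]; rewrite !inE.
  by apply/forall_inP => c _; rewrite big1 // => i _; rewrite mxE mul0r.
move=> /forall_inP Cu /forall_inP Cv; apply/forall_inP => c Cc.
under eq_bigr do rewrite !mxE mulrBl.
by rewrite sumrB (eqP (Cu c Cc)) (eqP (Cv c Cc)) subr0.
Qed.

End HammingLinear.

(** * Relations between powers of an element *)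

Section Syndrome.

Variables (F : fieldType) (E : algType F) (b : E) (n : nat).

(** The powers of [b] act as a one-row parity-check matrix with entries in the extension; for
    [b = beta] the kernel is the dual code. *)
Definition syndrome (u : 'rV[F]_n) : E := \sum_i u 0 i *: b ^+ i.

Lemma syndrome_is_linear : linear syndrome.
Proof.
move=> c u v; rewrite /syndrome scaler_sumr -big_split /=.
by apply: eq_bigr => i _; rewrite !mxE scalerDl scalerA.
Qed.

HB.instance Definition _ :=
  GRing.isLinear.Build F 'rV[F]_n E *:%R syndrome syndrome_is_linear.

Lemma syndrome_delta i : syndrome (delta_mx 0 i) = b ^+ i.
Proof.
rewrite /syndrome (bigD1 i) //= mxE !eqxx scale1r big1 ?addr0 // => j ne_ji.
by rewrite mxE (negPf ne_ji) andbF scale0r.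
Qed.

Lemma syndrome_support (u : 'rV[F]_n) :
  syndrome u = \sum_(i in [set i | u 0 i != 0]) u 0 i *: b ^+ i.
Proof.
rewrite /syndrome [LHS](bigID (fun i => u 0 i != 0)) /= addrC big1 ?add0r.
  by apply: eq_bigl => i; rewrite inE.
by move=> i; rewrite negbK => /eqP->; rewrite scale0r.
Qed.

End Syndrome.

(** * Trace and base field of a quadratic extension *)

Section QuadraticExtension.

Variables (F : finFieldType) (L : fieldExtType F).
Local Notation E := (finvect_type L).
Hypothesis cardE : #|E| = (#|F| ^ 2)%N.

Lemma mem_base_Frobenius (x : E) : (x \in 1%VS) = (x ^+ #|F| == x).
Proof.
by have := Fermat's_little_theorem 1%AS x; rewrite dimv1 expn1.
Qed.

Lemma dim_quadratic : \dim {: E} = 2%N.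
Proof.
apply: (expnI (finNzRing_gt1 F)).
by rewrite -card_vspace card_vspacef cardE.
Qed.

(** The Galois group has order 2, so it consists of the identity and the Frobenius generator [g]. *)
Lemma Tr_quadratic (x : E) : (Tr x)%:A = x + x ^+ #|F| :> E.
Proof.
rewrite TrE /galTrace.
have [g genG gE] := finField_galois_generator (sub1v {:E}%AS).
have oG : #|'Gal({:E} / 1)%g| = 2%N.
  by rewrite -galois_dim ?finField_galois ?sub1v // dim_quadratic dimv1 divn1.
have G_E : 'Gal({:E} / 1)%g = [set 1%g; g].
  apply/eqP; rewrite eq_sym eqEcard oG cards2.
  have gG : g \in 'Gal({:E} / 1)%g by rewrite (eqP genG) cycle_id.
  have g1 : g != 1%g.
    by apply: contra_eqN oG => /eqP g1; rewrite (eqP genG) g1 cycle1 cards1.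
  rewrite [1%g == g]eq_sym g1 leqnn andbT.
  by apply/subsetP=> h /set2P[]->; rewrite ?group1.
rewrite G_E big_setU1 ?big_set1 /=.
  by rewrite gal_id gE ?memvf // dimv1 expn1.
rewrite inE; apply: contra_eqN oG => /eqP g1.
by rewrite (eqP genG) -g1 cycle1 cards1.
Qed.

Lemma Tr_is_linear : linear (@Tr F L : E -> F^o).
Proof.
move=> c x y; apply: (fmorph_inj (in_alg E)).
rewrite /= scalerDl -scalerA !TrE /galTrace scaler_sumr -big_split /=.
by apply: eq_bigr => g _; rewrite linearP.
Qed.

HB.instance Definition _ :=
  GRing.isLinear.Build F E F^o *:%R (@Tr F L) Tr_is_linear.

Lemma trace_codeword_is_linear n (b : E) :
  linear (trace_codeword n b : E -> 'rV[F]_n).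
Proof.
move=> c x y; apply/rowP=> i; rewrite !mxE mulrDl -scalerAl.
exact: (linearP (@Tr F L : {linear E -> F^o})).
Qed.

HB.instance Definition _ n (b : E) :=
  GRing.isLinear.Build F E 'rV[F]_n *:%R (trace_codeword n b)
    (trace_codeword_is_linear n b).

Lemma Tr_eq0 (x : E) : 2%N \in [pchar F] -> (Tr x == 0) = (x \in 1%VS).
Proof.
move=> pF2; have pE2 : 2%N \in [pchar E] by rewrite (pchar_lalg E).
rewrite -(fmorph_eq0 (in_alg E)) /= Tr_quadratic mem_base_Frobenius.
by rewrite addr_eq0 oppr_pchar2 // eq_sym.
Qed.

Section PrimitiveElement.

Variable alpha : {unit E}.
Hypothesis gen_alpha : generator [set: {unit E}] alpha.

Lemma unit_exp_primitive (x : E) : x != 0 -> exists s, x = val alpha ^+ s.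
Proof.
rewrite -unitfE => Ux.
have : (FinRing.unit E Ux) \in <[alpha]>%g by rewrite -(eqP gen_alpha) inE.
case/cycleP=> s /(congr1 val) /= ->; exists s.
by rewrite FinRing.val_unitX.
Qed.

(** Since [alpha] has order [(q + 1)(q - 1)], its power [alpha^s] is fixed by Frobenius exactly when
    that order divides [s (q - 1)]; then [q - 1] cancels. *)
Lemma mem_base_primitive s :
  (val alpha ^+ s \in (1%VS : {vspace E})) = (#|F|.+1 %| s)%N.
Proof.
have q_gt1 := finNzRing_gt1 F.
rewrite mem_base_Frobenius -exprM -!FinRing.val_unitX val_eqE.
rewrite eq_expg_mod_order orderE -(eqP gen_alpha) card_finField_unit cardE.
rewrite eqn_mod_dvd; last by rewrite -{1}[s]muln1 leq_mul2l ltnW ?orbT.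
rewrite -{2}[s]muln1 -mulnBr.
have -> : ((#|F| ^ 2).-1 = #|F|.+1 * (#|F| - 1))%N.
  by rewrite -subn1 -[X in (_ - X)%N](exp1n 2) subn_sqr addn1 mulnC.
by rewrite dvdn_pmul2r // subn_gt0.
Qed.

(** * Weights of the trace code *)

Hypothesis pF2 : 2%N \in [pchar F].
Variables (N e : nat).
Hypotheses (coqN : coprime #|F|.+1 N) (e_gt0 : (0 < e)%N).
Local Notation n := (#|F|.+1 * e)%N.
Local Notation beta := (val alpha ^+ N : E).
Local Notation C := (trace_code n beta).

Let alpha_neq0 : val alpha != 0.
Proof. by rewrite -unitfE; apply: (valP alpha). Qed.

Lemma hamming_weight_trace_codeword (a : E) : a != 0 ->
  hamming_weight (trace_codeword n beta a) = (#|F| * e)%N.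
Proof.
case/unit_exp_primitive=> s ->.
have <- : (n - e = #|F| * e)%N by rewrite mulSn addKn.
rewrite /hamming_weight -[X in (X - e)%N]card_ord.
rewrite -(cardsC [set i : 'I_n | trace_codeword n beta (val alpha ^+ s) 0 i != 0]).
(* It is the zero coordinates that are counted: the [i] with [q + 1] dividing [s + N * i]. *)
suff -> : #|~: [set i | trace_codeword n beta (val alpha ^+ s) 0 i != 0]| = e.
  by rewrite addnK.
rewrite -[RHS](@sum_dvdn_progression #|F|.+1 e N s) // -sum1_card big_mkcond /=.
apply: eq_bigr => i _; rewrite !inE negbK mxE Tr_eq0 // -exprM -exprD.
by rewrite mem_base_primitive; case: dvdn.
Qed.

(** A nonzero [a] gives a word of positive weight, so the kernel is trivial. This yields both the
    dimension and the number of words. *)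
Lemma trace_codeword_inj : injective (trace_codeword n beta).
Proof.
apply: raddf_inj => a; apply: contra_eq => /hamming_weight_trace_codeword.
apply: contra_eq_neq => ->; rewrite hamming_weight0 eq_sym -lt0n muln_gt0 e_gt0.
by rewrite ltnW ?finNzRing_gt1.
Qed.

Lemma weight_trace_code c : c \in C -> c != 0 ->
  hamming_weight c = (#|F| * e)%N.
Proof.
case/imsetP=> a _ -> nz_c; apply: hamming_weight_trace_codeword.
by apply: contraNneq nz_c => ->; rewrite raddf0.
Qed.

Lemma trace_code_linear : is_linear_code C 2 (#|F| * e).
Proof.
have CV : C =i limg (linfun (trace_codeword n beta)).
  move=> c; apply/imsetP/memv_imgP => [][a _ ->]; exists a; rewrite ?memvf //.
    by rewrite lfunE.
  by rewrite lfunE.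
split.
  exists (limg (linfun (trace_codeword n beta))); split=> //.
  rewrite limg_dim_eq ?dim_quadratic //; apply/eqP.
  rewrite capfv; apply/lker0P => a b; rewrite !lfunE; apply: trace_codeword_inj.
apply: is_min_distance_weight => [||c Cc nz_c]; last 1 first.
- by rewrite weight_trace_code.
- by split=> [|u v]; rewrite !CV ?mem0v //; apply: memvB.
exists (trace_codeword n beta 1); first exact: imset_f.
split; last by rewrite hamming_weight_trace_codeword ?oner_neq0.
by rewrite -(raddf0 (trace_codeword n beta)) (inj_eq trace_codeword_inj) oner_neq0.
Qed.

Lemma weight_enumerator_trace_code :
  weight_enumerator C = 1 + (#|F| ^ 2 - 1)%N%:R *: 'X^(e * #|F|).
Proof.
rewrite weight_enumeratorE big_imset /=; last by move=> a b _ _ /trace_codeword_inj.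
rewrite (bigD1 0) ?inE //= raddf0 hamming_weight0 expr0; congr (_ + _).
rewrite (eq_bigr (fun=> 'X^(e * #|F|))); last first.
  by move=> a nz_a; rewrite hamming_weight_trace_codeword // mulnC.
rewrite sumr_const scaler_nat; congr (_ *+ _).
rewrite subn1 -cardE -(cardC1 (0 : E)).
by apply: eq_card => a; rewrite !inE.
Qed.

(** * Minimum distance of the dual code *)

Lemma dual_trace_codeE (u : 'rV[F]_n) :
  (u \in dual_code C) = (syndrome beta u == 0).
Proof.
have sumTr a : \sum_i u 0 i * trace_codeword n beta a 0 i
             = Tr (a * syndrome beta u).
  rewrite mulr_sumr raddf_sum; apply: eq_bigr => i _ /=.
  by rewrite mxE -scalerAr linearZ.
rewrite inE; apply/forall_inP/eqP => [Cu | u0 _ /imsetP[a _ ->]]; last first.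
  by rewrite sumTr u0 mulr0 raddf0.
apply/eqP; apply: contraT => nz_y.
(* This choice makes the inner product equal to [Tr alpha], which is nonzero because [q + 1] does
   not divide the exponent 1. *)
have /Cu : trace_codeword n beta (val alpha / syndrome beta u) \in C.
  exact: imset_f.
rewrite sumTr mulfVK // Tr_eq0 // -[val alpha]expr1 mem_base_primitive.
by rewrite dvdn1 eqSS -(subnKC (finNzRing_gt1 F)).
Qed.

(** Weight 1 would make a nonzero multiple of a power of [beta] vanish. *)
Lemma dual_trace_code_weight_gt1 u :
  u \in dual_code C -> u != 0 -> (1 < hamming_weight u)%N.
Proof.
rewrite dual_trace_codeE syndrome_support => /eqP u0 nz_u.
rewrite ltnNge leq_eqVlt ltnS leqn0; apply/norP; split.
  apply/negP=> /cards1P[i Di]; move: u0; rewrite Di big_set1 => /eqP.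
  rewrite scaler_eq0 !expf_eq0 (negPf alpha_neq0) !andbF orbF.
  by have := set11 i; rewrite -Di inE => /negPf->.
apply: contraNN nz_u; rewrite cards_eq0 => /eqP/setP u_0.
by apply/eqP/rowP=> i; have := u_0 i; rewrite !inE mxE => /negbFE/eqP.
Qed.

(** If [y] were nonzero, dividing by [beta^i] would put [beta^(j - i)] in the base field; then
    [q + 1] would divide [N (j - i)], hence [j - i], which lies strictly between 0 and [q + 1]. *)
Lemma base_independent_powers (i j : nat) (x y : F) : (i < j <= i + #|F|)%N ->
  x *: beta ^+ i + y *: beta ^+ j = 0 -> y = 0.
Proof.
case/andP=> lt_ij le_ji; rewrite -{1}(subnKC (ltnW lt_ij)) exprD -mulr_algl.
rewrite [y *: _]scalerAr -[x%:A * _]mulrC -mulrDr => /eqP.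
rewrite mulf_eq0 !expf_eq0 (negPf alpha_neq0) !andbF /= => /eqP xy0.
apply/eqP; apply: contraT => nz_y.
have : beta ^+ (j - i) \in (1%VS : {vspace E}).
  rewrite -[beta ^+ _](scalerK nz_y) memvZ // -(addKr x%:A (y *: _)) xy0 addr0.
  by rewrite memvN memvZ ?mem1v.
rewrite -exprM mem_base_primitive Gauss_dvdr // gtnNdvd ?subn_gt0 //.
by rewrite ltnS leq_subLR.
Qed.

(** In length [q + 1] two positions differ by at most [q], so a word of weight 2 contradicts
    [base_independent_powers]. *)
Lemma dual_trace_code_weight_gt2 u : e = 1%N ->
  u \in dual_code C -> u != 0 -> (2 < hamming_weight u)%N.
Proof.
move=> e1 Cu nz_u; rewrite ltn_neqAle dual_trace_code_weight_gt1 // andbT.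
apply/negP; rewrite eq_sym => /cards2P[i [j [ne_ij Dij]]].
move: Cu; rewrite dual_trace_codeE syndrome_support Dij big_setU1 ?inE //=.
rewrite big_set1 => /eqP.
have le_n (l : 'I_n) : (l <= #|F|)%N.
  by have := ltn_ord l; rewrite {2}e1 muln1 ltnS.
wlog lt_ij : i j ne_ij Dij / (i < j)%N.
  move=> W; case: (ltngtP i j) => [|lt_ji|/val_inj Eij]; first exact: W.
    by rewrite addrC; apply: W => //; rewrite 1?eq_sym // setUC.
  by rewrite Eij eqxx in ne_ij.
have nz_uj : u 0 j != 0 by have := set22 i j; rewrite -Dij inE.
move=> /base_independent_powers uj0; move: nz_uj; rewrite uj0 ?eqxx //.
by rewrite lt_ij (leq_trans (le_n j)) ?leq_addl.
Qed.

(** The scalar is the norm of [beta], the product of [beta] and its conjugate [beta^q]. *)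
Lemma exp_base_primitive : {y : F | beta ^+ #|F|.+1 = y%:A}.
Proof.
apply/sig_eqW/vlineP.
by rewrite -exprM mem_base_primitive dvdn_mull.
Qed.

Lemma dual_trace_code_distance2 : (1 < e)%N -> is_min_distance (dual_code C) 2.
Proof.
move=> e_gt1; apply: is_min_distance_weight; first exact: dual_code_zmod_closed.
  (* Position [q + 1] exists because [e > 1]; the word [u] below encodes the relation between
     [beta^(q + 1)] and [beta^0]. *)
  have lt_q : (#|F|.+1 < n)%N by rewrite ltn_Pmulr.
  pose i0 := Ordinal (ltn_trans (ltn0Sn _) lt_q); pose i1 := Ordinal lt_q.
  have [y Dy] := exp_base_primitive.
  pose u : 'rV[F]_n := delta_mx 0 i1 - y *: delta_mx 0 i0.
  have Cu : u \in dual_code C.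
    by rewrite dual_trace_codeE linearB linearZ /= !syndrome_delta Dy subrr.
  have nz_u : u != 0.
    apply/eqP=> /rowP/(_ i1)/eqP.
    by rewrite !mxE !eqxx /= mulr0 subr0 oner_eq0.
  exists u => //; split=> //; apply/eqP.
  rewrite eqn_leq dual_trace_code_weight_gt1 // andbT.
  apply: leq_trans (_ : #|[set i0; i1]| <= _)%N; last by rewrite cards2.
  apply: subset_leq_card; apply/subsetP=> i; rewrite !inE; apply: contraNT.
  by case/norP=> /negPf i_0 /negPf i_1; rewrite !mxE i_0 i_1 /= mulr0 subr0.
exact: dual_trace_code_weight_gt1.
Qed.

Lemma dual_trace_code_distance3 : e = 1%N -> is_min_distance (dual_code C) 3.
Proof.
move=> e1; apply: is_min_distance_weight; first exact: dual_code_zmod_closed.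
  have lt2 : (2 < n)%N by rewrite e1 muln1 ltnS finNzRing_gt1.
  pose i2 := Ordinal lt2; pose i1 := Ordinal (ltnW lt2).
  pose i0 := Ordinal (ltnW (ltnW lt2)).
  have [y Dy] := exp_base_primitive.
  (* The roots of this quadratic are [beta] and [beta^q], with sum [Tr beta] and product [y]. *)
  have min_poly : beta ^+ 2 - Tr beta *: beta ^+ 1 + y *: beta ^+ 0 = 0.
    rewrite -Dy expr1 -mulr_algl Tr_quadratic mulrDl -expr2 -exprSr opprD.
    by rewrite addNKr addNr.
  pose u : 'rV[F]_n :=
    delta_mx 0 i2 - Tr beta *: delta_mx 0 i1 + y *: delta_mx 0 i0.
  have Cu : u \in dual_code C.
    rewrite dual_trace_codeE linearD linearB !linearZ /= !syndrome_delta /=.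
    by rewrite scalerN min_poly.
  have nz_u : u != 0.
    apply/eqP=> /rowP/(_ i2)/eqP.
    by rewrite !mxE !eqxx /= !mulr0 subr0 addr0 oner_eq0.
  exists u => //; split=> //; apply/eqP.
  (* The support of [u] lies in three positions, and the lower bound on weights forces it to fill
     them. *)
  rewrite eqn_leq dual_trace_code_weight_gt2 // andbT.
  apply: leq_trans (_ : #|[set i0; i1; i2]| <= _)%N; last first.
    by rewrite setUC cardsU1 cards2 !inE.
  apply: subset_leq_card; apply/subsetP=> i; rewrite !inE; apply: contraNT.
  case/norP=> /norP[/negPf i_0 /negPf i_1] /negPf i_2.
  by rewrite !mxE i_0 i_1 i_2 /= !mulr0 subr0 addr0.
by move=> c; apply: dual_trace_code_weight_gt2.
Qed.

End PrimitiveElement.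

End QuadraticExtension.

Theorem theorem3 (m k : nat) (F : finFieldType) (L : fieldExtType F)
    (alpha : {unit finvect_type L}) :
  (1 <= m)%N -> (1 <= k)%N ->
  let q := (2 ^ (k * m))%N in
  let d := (2 ^ m)%N in
  let n := ((q + 1) * (d - 1))%N in
  let N := ((q - 1) %/ (d - 1))%N in
  let r := (q ^ 2)%N in
  #|F| = q ->
  #|finvect_type L| = r ->
  generator [set: {unit finvect_type L}] alpha ->
  let beta := val alpha ^+ N in
  let C := trace_code n beta in
  [/\ is_linear_code C 2%N (n - d + 1)%N,
      weight_enumerator C = 1 + (q ^ 2 - 1)%N%:R *: 'X^((d - 1) * q)
    & is_min_distance (dual_code C) (if m == 1%N then 3%N else 2%N)].
Proof.
move=> m_gt0 k_gt0 q d n N r cardF cardE gen_alpha beta C.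
have d_gt1 : (1 < d)%N by rewrite -{1}(expn0 2) ltn_exp2l.
have e_gt0 : (0 < d - 1)%N by rewrite subn_gt0.
have pF2 : 2%N \in [pchar F] by apply: card_finPcharP cardF _.
(* As [q] is a power of [d], [d - 1] divides [q - 1], so [N] divides [q - 1]; and [q + 1] is prime
   to [q - 1], their difference being 2 and [q - 1] odd. *)
have coqN : coprime #|F|.+1 N.
  have dvdNq : (N %| q - 1)%N.
    apply/dvdnP; exists (d - 1)%N; rewrite mulnC divnK //.
    by rewrite /q mulnC expnM !subn1 predn_exp dvdn_mulr.
  apply: coprime_dvdr dvdNq _.
  have q_gt0 : (0 < q)%N by rewrite expn_gt0.
  have -> : (#|F|.+1 = 2 + (q - 1))%N by rewrite cardF add2n subn1 prednK.
  rewrite coprime_sym /coprime gcdnDr -/(coprime _ _) coprimen2 subn1.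
  by rewrite -[odd _]negbK -oddS prednK // oddX muln_eq0 !gtn_eqF.
have cardE' : #|finvect_type L| = (#|F| ^ 2)%N by rewrite cardF.
have nE : n = (#|F|.+1 * (d - 1))%N by rewrite /n addn1 cardF.
(* The natural subtraction is exact because [d <= n]; the identity is then
   [n = (d - 1) + q (d - 1)]. *)
have wE : (n - d + 1 = #|F| * (d - 1))%N.
  have le_dn : (d <= n)%N.
    rewrite nE mulSn -{1}(subnK (ltnW d_gt1)) leq_add2l muln_gt0 e_gt0 andbT.
    by rewrite ltnW ?finNzRing_gt1.
  rewrite addn1 -subSn // -{1}(subnK (ltnW d_gt1)) addn1 subSS nE mulSn.
  exact: addKn.
(* The length occurs in the type of the code, so [n] is made a variable and substituted to reach the
   form [(q + 1) * e]. *)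
rewrite wE /C; clear wE C; clearbody n; subst n; split.
- exact: trace_code_linear.
- by rewrite -cardF; apply: weight_enumerator_trace_code.
case: eqP => [m1 | m1].
  by apply: dual_trace_code_distance3; rewrite // /d m1.
apply: dual_trace_code_distance2 => //.
rewrite ltn_subRL -{1}[(1 + 1)%N](expn1 2) ltn_exp2l // ltn_neqAle m_gt0 andbT.
by rewrite eq_sym; apply/eqP.
Qed.
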